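(* Let $\mathbb{T}$ be a time scale, let $a,b\in\mathbb{T}$ with $a<b$, let $I\subset\mathbb{R}$ be an interval, and let $F:I\to\mathbb{R}$ be a convex function. Let $x,y,p:[a,b]_{\mathbb{T}}\to I$ with $p$ nonnegative on $[a,b]_{\mathbb{T}}$. Let $\varphi\in\partial F$ and let $g:[a,b]_{\mathbb{T}}\to I$ be non-decreasing on $[a,b]_{\mathbb{T}}$. Then, assuming that the four Riemann--Stieltjes $\Delta$-integrals below exist, $$\int_a^b p(t)F(x(t))\,\Delta g(t)-\int_a^b p(t)F(y(t))\,\Delta g(t)\;\geq\;\int_a^b p(t)x(t)\varphi(y(t))\,\Delta g(t)-\int_a^b p(t)y(t)\varphi(y(t))\,\Delta g(t).$$
   Context: A time scale $\mathbb{T}$ is a nonempty closed subset of $\mathbb{R}$, and $[a,b]_{\mathbb{T}}:=[a,b]\cap\mathbb{T}$, $[a,b)_{\mathbb{T}}:=[a,b)\cap\mathbb{T}$. For a convex function $F:I\to\mathbb{R}$, the subdifferential $\partial F$ is the set of all functions $\varphi:I\to\mathbb{R}\cup\{\pm\infty\}$ such that $\varphi(\mathrm{int}(I))\subset\mathbb{R}$ and $F(x)\geq F(y)+(x-y)\varphi(y)$ for all $x,y\in I$ (with the convention $0\cdot(\pm\infty)=0$). Riemann--Stieltjes $\Delta$-integral: let $f,g$ be bounded real-valued functions on $[a,b]_{\mathbb{T}}$ with $g$ non-decreasing on $[a,b]_{\mathbb{T}}$. A partition of $[a,b]_{\mathbb{T}}$ is a finite set $P=\{t_0,\dots,t_n\}\subset[a,b]_{\mathbb{T}}$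 with $a=t_0<t_1<\dots<t_n=b$; a partition $P\supset P^*$ is called a refinement of $P^*$. For a selection $X=\{x_1,\dots,x_n\}$ with $x_i\in[t_{i-1},t_i)_{\mathbb{T}}$ put $S_g(f,P,X)=\sum_{i=1}^n f(x_i)(g(t_i)-g(t_{i-1}))$. Then $f$ is Riemann--Stieltjes $\Delta$-integrable with respect to $g$ on $[a,b]_{\mathbb{T}}$ if there is a number $\mathcal{I}\in\mathbb{R}$ such that for every $\varepsilon>0$ there is a partition $P^*$ with $|S_g(f,P,X)-\mathcal{I}|<\varepsilon$ for all refinements $P\supset P^*$ and all selections $X$ for $P$; this (unique) number is denoted $\int_a^b f(t)\,\Delta g(t)=\mathcal{I}$. Existence of an integral includes that its integrand is a bounded real-valued function on $[a,b]_{\mathbb{T}}$. *)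

(* Defs.v *)
From HB Require Import structures.
From mathcomp Require Import all_boot all_order all_algebra.
From mathcomp Require Import all_classical all_reals all_analysis.

Set Implicit Arguments.
Unset Strict Implicit.
Unset Printing Implicit Defensive.

Import Order.TTheory GRing.Theory Num.Theory.
Import numFieldNormedType.Exports.

Local Open Scope classical_set_scope.
Local Open Scope ring_scope.

(* Functions defined on a subset of R (on I or on [a, b]_T) are represented by
   total functions on R; only their values on that subset are ever used. *)

Definition time_scale (R : realType) (T : set R) : Prop :=
  T !=set0 /\ closed T.

Definition ts_cc (R : realType) (T : set R) (a b : R) : set R :=
  `[a, b]%classic `&` T.

Definition ts_co (R : realType) (T : set R) (a b : R) : set R :=
  `[a, b[%classic `&` T.

(* The convention 0 * (+oo) = 0 * (-oo) = 0 is that of the multiplication of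
   extended reals in the library. *)
Definition subdifferential (R : realType) (I : set R) (F : R -> R) :
    set (R -> \bar R) :=
  [set phi | (forall u, I° u -> phi u \is a fin_num) /\
     (forall u v, I u -> I v ->
        ((F u)%:E >= (F v)%:E + (u - v)%:E * phi v)%E)].

(* The partition a = t_0 < t_1 < ... < t_n = b is encoded, as in [variation],
   by the sequence s = [:: t_1; ...; t_n], so that n = size s and
   t_i = nth b (a :: s) i. *)
Definition ts_partition (R : realType) (T : set R) (a b : R) (s : seq R) :
    Prop :=
  itv_partition a b s /\ (forall t, t \in a :: s -> ts_cc T a b t).

Definition ts_refinement (R : realType) (T : set R) (a b : R) (s0 s : seq R) :
    Prop :=
  ts_partition T a b s /\ {subset a :: s0 <= a :: s}.

(* Selections are indexed from 0: X i is the point chosen in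
   [t_i, t_(i+1))_T. *)
Definition ts_selection (R : realType) (T : set R) (a b : R) (s : seq R)
    (X : nat -> R) : Prop :=
  forall i, (i < size s)%N ->
    ts_co T (nth b (a :: s) i) (nth b (a :: s) i.+1) (X i).

(* Integrands are extended-real-valued expressions, since the values of a
   subgradient may be infinite; [RSdelta_has_integral] requires them to be
   bounded, hence finite, on [a, b]_T, so that [fine] is harmless. *)
Definition RSdelta_sum (R : realType) (a b : R) (f : R -> \bar R) (g : R -> R)
    (s : seq R) (X : nat -> R) : R :=
  \sum_(0 <= i < size s)
    fine (f (X i)) * (g (nth b (a :: s) i.+1) - g (nth b (a :: s) i)).

Definition real_bounded_on (R : realType) (A : set R) (f : R -> \bar R) :
    Prop :=
  exists M : R, forall t, A t -> (`|f t| <= M%:E)%E.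

(* The integrator g is meant to be non-decreasing on [a, b]_T, hence bounded
   there. *)
Definition RSdelta_has_integral (R : realType) (T : set R) (a b : R)
    (f : R -> \bar R) (g : R -> R) (l : R) : Prop :=
  real_bounded_on (ts_cc T a b) f /\
  forall e : R, 0 < e ->
    exists2 s0, ts_partition T a b s0 &
      forall s X, ts_refinement T a b s0 s -> ts_selection T a b s X ->
        `|RSdelta_sum a b f g s X - l| < e.

Definition RSdelta_integrable (R : realType) (T : set R) (a b : R)
    (f : R -> \bar R) (g : R -> R) : Prop :=
  exists l : R, RSdelta_has_integral T a b f g l.

(* 0 is a default value, used only when f is not integrable. *)
Definition RSdelta_integral (R : realType) (T : set R) (a b : R)
    (f : R -> \bar R) (g : R -> R) : R :=
  xget 0 [set l | RSdelta_has_integral T a b f g l].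

(* Main.v *)
Require Import Defs.
From HB Require Import structures.
From mathcomp Require Import all_boot all_order all_algebra.
From mathcomp Require Import all_classical all_reals all_analysis.
From mathcomp Require Import lra.

Set Implicit Arguments.
Unset Strict Implicit.
Unset Printing Implicit Defensive.

Import Order.TTheory GRing.Theory Num.Theory.
Import numFieldNormedType.Exports.

Local Open Scope classical_set_scope.
Local Open Scope ring_scope.

(** The subgradient inequality at [y t], multiplied by [p t >= 0], reads
    [p F(x) - p F(y) >= p x phi(y) - p y phi(y)] on [a, b]_T.  Since [g] is
    non-decreasing, integrating it against [g] gives the theorem, and this
    needs only that the integral is additive ([RSdelta_has_integralB]) and
    monotone ([RSdelta_has_integral_le]).

    The integral is a limit along the filter of refinements, so both
    properties come from the corresponding ones of Riemann-Stieltjes sums once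
    that filter is known to be closed under intersection
    ([RSdelta_eventually_and], from common refinements of partitions) and
    proper ([RSdelta_eventually_ex], from the selection of left endpoints).

    The pointwise step ([weighted_subgradient_le]) is delicate only where
    [phi (y t)] is infinite, which can happen when [y t] is an endpoint of the
    interval.  The integrands being bounded, [p t * x t] and [p t * y t]
    must then vanish: either [p t = 0], or [x t = y t = 0], and in both cases
    the two sides of the inequality are 0. *)

(** * Refinements and selections *)

(** The last point of a sequence increasing from [a] is its largest one, so a
    sequence of points of [a, b] ends at [b] as soon as it contains [b]. *)
Lemma itv_partition_mem (R : realType) (a b : R) (s : seq R) :
  path <%R a s -> (forall t, t \in a :: s -> t <= b) -> b \in a :: s ->
  itv_partition a b s.
Proof.
move=> sa s_le bs; split=> //.
rewrite eq_le s_le ?mem_last//=.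
have sp : itv_partition a (last a s) s by split.
rewrite -(nth_index (last a s) bs).
by apply: (itv_partition_nth_le _ sp); rewrite -/(size (a :: s)) index_mem.
Qed.

Lemma ts_common_refinement (R : realType) (T : set R) (a b : R)
    (s1 s2 : seq R) :
  ts_partition T a b s1 -> ts_partition T a b s2 ->
  exists s, ts_refinement T a b s1 s /\ ts_refinement T a b s2 s.
Proof.
move=> [[a_s1 /eqP s1b] s1T] [[a_s2 _] s2T].
set s := sort <=%R (undup (s1 ++ s2)).
have sE t : (t \in a :: s) = (t \in a :: s1) || (t \in a :: s2).
  by rewrite !inE mem_sort mem_undup mem_cat orbACA orbb.
have sT t : t \in a :: s -> ts_cc T a b t.
  by rewrite sE => /orP[/s1T|/s2T].
have a_s : path <%R a s.
  rewrite path_sortedE; last exact: lt_trans.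
  rewrite sort_lt_sorted undup_uniq andbT; apply/allP => t.
  rewrite mem_sort mem_undup mem_cat.
  by move/lt_path_min: a_s1 => /allP h1; move/lt_path_min: a_s2 => /allP h2;
    move=> /orP[/h1|/h2].
have sp : ts_partition T a b s.
  split=> //; apply: itv_partition_mem => //.
    by move=> t /sT[/=]; rewrite in_itv/= => /andP[].
  by rewrite sE -{1}s1b mem_last.
by exists s; split; split=> // t ts; rewrite sE ts ?orbT.
Qed.

(** Membership in the filter along which the Riemann-Stieltjes sums converge
    to the integral. *)
Definition RSdelta_eventually (R : realType) (T : set R) (a b : R)
    (P : seq R -> (nat -> R) -> Prop) : Prop :=
  exists2 s0, ts_partition T a b s0 &
    forall s X, ts_refinement T a b s0 s -> ts_selection T a b s X -> P s X.

Lemma RSdelta_eventually_and (R : realType) (T : set R) (a b : R)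
    (P Q : seq R -> (nat -> R) -> Prop) :
  RSdelta_eventually T a b P -> RSdelta_eventually T a b Q ->
  RSdelta_eventually T a b (fun s X => P s X /\ Q s X).
Proof.
move=> [s1 ps1 h1] [s2 ps2 h2].
have [s0 [[ps0 s10] [_ s20]]] := ts_common_refinement ps1 ps2.
exists s0 => // s X [ps s0s] sX; split.
- by apply: h1 => //; split=> // t /s10/s0s.
- by apply: h2 => //; split=> // t /s20/s0s.
Qed.

Lemma ts_partition_nth (R : realType) (T : set R) (a b : R) (s : seq R) i :
  ts_partition T a b s -> (i <= size s)%N -> ts_cc T a b (nth b (a :: s) i).
Proof. by move=> [_ sT] ile; apply: sT; rewrite mem_nth. Qed.

(** The left endpoints of the subintervals form a selection, so that
    selections exist for every partition. *)
Lemma RSdelta_eventually_ex (R : realType) (T : set R) (a b : R)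
    (P : seq R -> (nat -> R) -> Prop) :
  RSdelta_eventually T a b P ->
  exists s X, [/\ ts_partition T a b s, ts_selection T a b s X & P s X].
Proof.
move=> [s ps h].
have sX : ts_selection T a b s (nth b (a :: s)).
  move=> i ilt; have [[/(pathP b) as_ _] _] := ps.
  split; last by case: (ts_partition_nth ps (ltnW ilt)).
  by rewrite /= in_itv/= lexx/=; exact: as_.
exists s, (nth b (a :: s)); split=> //; apply: h => //.
by split=> //.
Qed.

Lemma ts_selection_in (R : realType) (T : set R) (a b : R) (s : seq R)
    (X : nat -> R) i :
  ts_partition T a b s -> ts_selection T a b s X -> (i < size s)%N ->
  ts_cc T a b (X i).
Proof.
move=> ps sX ilt; have [+ TX] := sX i ilt.
have [+ _] := ts_partition_nth ps (ltnW ilt).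
have [+ _] := ts_partition_nth ps ilt.
rewrite /= !in_itv/= => /andP[_ tb] /andP[ta _] /andP[tX Xt].
by split=> //=; rewrite in_itv/= (le_trans ta)//= (le_trans (ltW Xt)).
Qed.

(** * Additivity and monotonicity of the integral *)

Lemma real_bounded_on_fin_num (R : realType) (A : set R) (f : R -> \bar R) t :
  real_bounded_on A f -> A t -> f t \is a fin_num.
Proof.
by move=> [M fM] /fM ftM; rewrite fin_num_abs (le_lt_trans ftM)// ltry.
Qed.

Lemma RSdelta_integralP (R : realType) (T : set R) (a b : R)
    (f : R -> \bar R) (g : R -> R) :
  RSdelta_integrable T a b f g ->
  RSdelta_has_integral T a b f g (RSdelta_integral T a b f g).
Proof. by move=> [l fl]; exact: (@xgetI _ 0 _ l). Qed.

Lemma RSdelta_has_integralB (R : realType) (T : set R) (a b : R)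
    (f1 f2 : R -> \bar R) (g : R -> R) (l1 l2 : R) :
  RSdelta_has_integral T a b f1 g l1 -> RSdelta_has_integral T a b f2 g l2 ->
  RSdelta_has_integral T a b (fun t => (f1 t - f2 t)%E) g (l1 - l2).
Proof.
move=> [bf1 int1] [bf2 int2]; split.
  have [M1 f1M] := bf1; have [M2 f2M] := bf2.
  exists (M1 + M2) => t tab.
  by rewrite (le_trans (lee_abs_sub _ _))// EFinD leeD ?f1M ?f2M.
move=> e e0.
have e20 : 0 < e / 2 by rewrite divr_gt0.
have [s0 ps0 h] := RSdelta_eventually_and (int1 _ e20) (int2 _ e20).
exists s0 => // s X s0s sX; have [d1 d2] := h _ _ s0s sX.
have -> : RSdelta_sum a b (fun t => (f1 t - f2 t)%E) g s X =
    RSdelta_sum a b f1 g s X - RSdelta_sum a b f2 g s X.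
  rewrite /RSdelta_sum -sumrB; apply: eq_big_nat => i /andP[_ ilt].
  have Xi := ts_selection_in s0s.1 sX ilt.
  by rewrite fineB ?mulrBl//; apply: real_bounded_on_fin_num Xi.
rewrite [e]splitr (_ : _ - _ = (RSdelta_sum a b f1 g s X - l1) -
                     (RSdelta_sum a b f2 g s X - l2)); last by lra.
by rewrite (le_lt_trans (ler_normB _ _))// ltrD.
Qed.

Lemma RSdelta_sum_le (R : realType) (T : set R) (a b : R)
    (f1 f2 : R -> \bar R) (g : R -> R) (s : seq R) (X : nat -> R) :
  {in ts_cc T a b &, {homo g : u v / u <= v}} ->
  (forall t, ts_cc T a b t -> fine (f1 t) <= fine (f2 t)) ->
  ts_partition T a b s -> ts_selection T a b s X ->
  RSdelta_sum a b f1 g s X <= RSdelta_sum a b f2 g s X.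
Proof.
move=> g_nd f12 ps sX; apply: ler_sum_nat => i /andP[_ ilt].
apply: ler_wpM2r; last exact/f12/(ts_selection_in ps sX ilt).
rewrite subr_ge0 g_nd ?inE//; last first.
  have [+ _] := sX i ilt; rewrite /= in_itv/= => /andP[tX Xt].
  exact: le_trans tX (ltW Xt).
- exact: ts_partition_nth.
- exact: ts_partition_nth ps (ltnW ilt).
Qed.

Lemma RSdelta_has_integral_le (R : realType) (T : set R) (a b : R)
    (f1 f2 : R -> \bar R) (g : R -> R) (l1 l2 : R) :
  {in ts_cc T a b &, {homo g : u v / u <= v}} ->
  (forall t, ts_cc T a b t -> (f1 t <= f2 t)%E) ->
  RSdelta_has_integral T a b f1 g l1 -> RSdelta_has_integral T a b f2 g l2 ->
  l1 <= l2.
Proof.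
move=> g_nd f12 [bf1 int1] [bf2 int2]; rewrite leNgt; apply/negP => l21.
have e0 : 0 < (l1 - l2) / 2 by rewrite divr_gt0// subr_gt0.
have [s [X [ps sX [d1 d2]]]] := RSdelta_eventually_ex
  (RSdelta_eventually_and (int1 _ e0) (int2 _ e0)).
have : RSdelta_sum a b f1 g s X <= RSdelta_sum a b f2 g s X.
  apply: (RSdelta_sum_le g_nd) ps sX => t tab.
  by apply: fine_le (f12 _ tab); exact: real_bounded_on_fin_num tab.
by move: d1 d2; rewrite !ltr_norml => /andP[? ?] /andP[? ?]; lra.
Qed.

(** * The weighted subgradient inequality *)

Lemma mule_fin_num_eq0 (R : realType) (r : R) (k : \bar R) :
  k \isn't a fin_num -> (r%:E * k)%E \is a fin_num -> r = 0.
Proof.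
case: k => [//| |] _.
- by rewrite mulry; case: sgrP => // _; rewrite ?mul1e ?mulN1e.
- by rewrite mulrNy; case: sgrP => // _; rewrite ?mul1e ?mulN1e.
Qed.

(** When [k] is infinite, the finiteness hypotheses force [q * u = q * v = 0],
    hence [q = 0] or [u = v = 0]. *)
Lemma weighted_subgradient_le (R : realType) (q u v Fu Fv : R) (k : \bar R) :
  0 <= q -> (Fv%:E + (u - v)%:E * k <= Fu%:E)%E -> (u = v -> Fu = Fv) ->
  ((q * u)%:E * k)%E \is a fin_num -> ((q * v)%:E * k)%E \is a fin_num ->
  ((q * u)%:E * k - (q * v)%:E * k <= (q * Fu)%:E - (q * Fv)%:E)%E.
Proof.
move=> q0 sub uvF finu finv.
have [kfin|kinf] := boolP (k \is a fin_num).
  move: sub; rewrite -(fineK kfin) -!EFinM -!EFinB -EFinD !lee_fin => sub.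
  rewrite -!mulrA -!mulrBr ler_wpM2l// -mulrBl; lra.
have qu0 := mule_fin_num_eq0 kinf finu.
have qv0 := mule_fin_num_eq0 kinf finv.
rewrite qu0 qv0 !mul0e sube0 -EFinB lee_fin -mulrBr.
have [->|qn0] := eqVneq q 0; first by rewrite mul0r.
have uv : u = v by apply: (mulfI qn0); rewrite qu0 qv0.
by rewrite (uvF uv) subrr mulr0.
Qed.

Theorem theorem12 (R : realType) (T : set R) (hT : time_scale T)
    (a b : R) (Ta : T a) (Tb : T b) (ab : a < b)
    (I : set R) (hI : is_interval I)
    (F : R -> R) (hF : convex_function (I : set R^o) (F : R^o -> R^o))
    (x y p : R -> R)
    (hx : forall t, ts_cc T a b t -> I (x t))
    (hy : forall t, ts_cc T a b t -> I (y t))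
    (hp : forall t, ts_cc T a b t -> I (p t))
    (p_ge0 : forall t, ts_cc T a b t -> 0 <= p t)
    (phi : R -> \bar R) (hphi : subdifferential I F phi)
    (g : R -> R) (hg : forall t, ts_cc T a b t -> I (g t))
    (g_nd : {in ts_cc T a b &, {homo g : s t / s <= t}})
    (int_pFx : RSdelta_integrable T a b (fun t => (p t * F (x t))%:E) g)
    (int_pFy : RSdelta_integrable T a b (fun t => (p t * F (y t))%:E) g)
    (int_pxphi : RSdelta_integrable T a b
       (fun t => ((p t * x t)%:E * phi (y t))%E) g)
    (int_pyphi : RSdelta_integrable T a b
       (fun t => ((p t * y t)%:E * phi (y t))%E) g) :
  RSdelta_integral T a b (fun t => (p t * F (x t))%:E) g
  - RSdelta_integral T a b (fun t => (p t * F (y t))%:E) g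
  >= RSdelta_integral T a b (fun t => ((p t * x t)%:E * phi (y t))%E) g
     - RSdelta_integral T a b (fun t => ((p t * y t)%:E * phi (y t))%E) g.
Proof.
have I_pFx := RSdelta_integralP int_pFx.
have I_pFy := RSdelta_integralP int_pFy.
have I_pxphi := RSdelta_integralP int_pxphi.
have I_pyphi := RSdelta_integralP int_pyphi.
apply: RSdelta_has_integral_le g_nd _ (RSdelta_has_integralB I_pxphi I_pyphi)
  (RSdelta_has_integralB I_pFx I_pFy) => t tab.
apply: weighted_subgradient_le => //.
- exact: p_ge0.
- by apply: hphi.2; [exact: hx|exact: hy].
- by move=> ->.
- exact: (real_bounded_on_fin_num I_pxphi.1 tab).
- exact: (real_bounded_on_fin_num I_pyphi.1 tab).
Qed.
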